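(* Let $J\subset\mathbb R$ be an interval, let $\alpha_1,\dots,\alpha_m\colon J\to\mathbb R$ be continuous functions linearly independent on $J$, let $A_1,\dots,A_m$ be pairwise commuting real constant $n\times n$ matrices, and let $B_j=A_j^{T}$. Suppose $\nu=\overset{*}{\nu}+\widetilde\nu\, i$ ($\overset{*}{\nu}=\mathrm{Re}\,\nu$, $\widetilde\nu=\mathrm{Im}\,\nu\neq0$) is a common complex eigenvector of the matrices $B_j$ corresponding to the eigenvalues $\lambda^{j}=\overset{*}{\lambda}{}^{j}+\widetilde\lambda{}^{j} i$ ($\overset{*}{\lambda}{}^{j}=\mathrm{Re}\,\lambda^{j}$, $\widetilde\lambda{}^{j}=\mathrm{Im}\,\lambda^{j}$), $j=1,\dots,m$. Fix $t_0\in J$. Then $$F_1\colon(t,x)\mapsto\bigl((\overset{*}{\nu}x)^2+(\widetilde\nu x)^2\bigr)\exp\Bigl(-2\int_{t_0}^{t}\sum_{j=1}^{m}\overset{*}{\lambda}{}^{j}\alpha_j(\tau)\,d\tau\Bigr)\quad\text{for all }(t,x)\in J\times\mathbb R^n$$ and $$F_2\colon(t,x)\mapsto\arctan\frac{\widetilde\nu x}{\overset{*}{\nu}x}-\int_{t_0}^{t}\sum_{j=1}^{m}\widetilde\lambda{}^{j}\alpha_j(\tau)\,d\tau\quad\text{for all }(t,x)\in J\times\mathscr X,$$ where $\mathscr X$ is any domain contained in $\{x\in\mathbb R^n\colon\overset{*}{\nu}x\neq0\}$, are first integrals of the (Lappo-Danilevskii) system $\dfrac{dx}{dt}=\sum_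{j=1}^{m}\alpha_j(t)A_jx$.
   Context: A domain is an open arcwise connected set. For a vector $\nu=(\nu_1,\dots,\nu_n)$ and $x\in\mathbb R^n$, $\nu x=\sum_{\xi=1}^n\nu_\xi x_\xi$; eigenvectors satisfy $B_j\nu=\lambda^{j}\nu$, $\nu\neq0$ regarded as a column. A first integral of $dx/dt=X(t,x)$ on a domain $G'$ is a continuously differentiable function $F\colon G'\to\mathbb R$ with $\partial_tF(t,x)+\sum_{\xi=1}^nX_\xi(t,x)\,\partial_{x_\xi}F(t,x)=0$ for all $(t,x)\in G'$. *)

(* Defs.v *)
From HB Require Import structures.
From mathcomp Require Import all_boot all_order all_algebra.
From mathcomp Require Import all_classical all_reals all_analysis.
From mathcomp.real_closed Require Import complex.

Set Implicit Arguments.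
Unset Strict Implicit.
Unset Printing Implicit Defensive.

Import Order.TTheory GRing.Theory Num.Theory.
Import numFieldNormedType.Exports.

Local Open Scope classical_set_scope.
Local Open Scope ring_scope.

Definition domain (R : realType) (T : topologicalType) (A : set T) : Prop :=
  open A /\
  forall x y, A x -> A y ->
    exists gamma : R -> T,
      [/\ {within `[0, 1], continuous gamma}, gamma 0 = x, gamma 1 = y &
          forall s, s \in `[0, 1] -> A (gamma s)].

(* A single point is not an interval here: derivatives on [J] must make sense. *)
Definition interval_set (R : realType) (J : set R) : Prop :=
  is_interval J /\ exists s t, [/\ J s, J t & s < t].

Definition lin_indep_on (R : realType) (J : set R) (m : nat)
    (alpha : 'I_m -> R -> R) : Prop :=
  forall c : 'I_m -> R,
    (forall t, J t -> \sum_(j < m) c j * alpha j t = 0) -> forall j, c j = 0.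

(* The oriented integral, so that [a] may exceed [b]. *)
Definition oint (R : realType) (a b : R) (f : R -> R) : R :=
  if a <= b then Rintegral lebesgue_measure `[a, b] f
  else - Rintegral lebesgue_measure `[b, a] f.

Section DeriveIn.
Context {R : realType} {V W : normedModType R}.

(* [derivable] and [derive] with the increments restricted to those that stay
   in [G]: they give one-sided derivatives at the ends of an interval, and on
   an open [G] they are the usual ones (see [derivable_inE], [derive_inE]). *)
Definition derivable_in (G : set V) (f : V -> W) (a v : V) : Prop :=
  cvg ((fun h => h^-1 *: ((f \o shift a) (h *: v) - f a)) @
         within [set h : R | G (h *: v + a)] 0^').

Definition derive_in (G : set V) (f : V -> W) (a v : V) : W :=
  lim ((fun h => h^-1 *: ((f \o shift a) (h *: v) - f a)) @
         within [set h : R | G (h *: v + a)] 0^').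

Lemma within_dnbhs_open (G : set V) (a v : V) : open G -> G a ->
  within [set h : R | G (h *: v + a)] 0^' = 0^'.
Proof.
move=> oG Ga.
have near_G : \forall h \near 0^', G ((h : R) *: v + a).
  apply: nbhs_dnbhs.
  have ct : (fun h : R => h *: v + a) @ 0 --> a.
    rewrite -[X in _ --> X]add0r -[X in _ --> X + _](scale0r v).
    by apply: cvgD; [exact: cvgZr_tmp | exact: cvg_cst].
  by apply: ct; exact: open_nbhs_nbhs.
apply/seteqP; split=> P; rewrite /within /=.
- by move=> wP; near=> h; apply: (near wP h) => //; near: h.
- by move=> PP; near=> h => _; near: h.
Unshelve. all: by end_near. Qed.

Lemma derivable_inE (G : set V) (f : V -> W) (a v : V) : open G -> G a ->
  derivable_in G f a v = derivable f a v.
Proof. by move=> oG Ga; rewrite /derivable_in within_dnbhs_open. Qed.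

Lemma derive_inE (G : set V) (f : V -> W) (a v : V) : open G -> G a ->
  derive_in G f a v = 'D_v f a.
Proof. by move=> oG Ga; rewrite /derive_in within_dnbhs_open. Qed.

End DeriveIn.

Section FirstIntegral.
Context {R : realType} {n : nat}.

Definition dir_t : R * 'cV[R]_n := (1, 0).
Definition dir_x (xi : 'I_n) : R * 'cV[R]_n := (0, delta_mx xi 0).

Definition has_continuous_partial (G : set (R * 'cV[R]_n))
    (F : R * 'cV[R]_n -> R) (v : R * 'cV[R]_n) : Prop :=
  (forall p, G p -> derivable_in G F p v) /\
  {within G, continuous (fun p => derive_in G F p v)}.

Definition continuously_differentiable (G : set (R * 'cV[R]_n))
    (F : R * 'cV[R]_n -> R) : Prop :=
  [/\ {within G, continuous F}, has_continuous_partial G F dir_t &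
      forall xi, has_continuous_partial G F (dir_x xi)].

Definition first_integral (X : R * 'cV[R]_n -> 'cV[R]_n)
    (G : set (R * 'cV[R]_n)) (F : R * 'cV[R]_n -> R) : Prop :=
  continuously_differentiable G F /\
  forall p, G p ->
    derive_in G F p dir_t + \sum_xi X p xi 0 * derive_in G F p (dir_x xi) = 0.

Definition pairing (u x : 'cV[R]_n) : R := \sum_xi u xi 0 * x xi 0.

End FirstIntegral.

Section LappoDanilevskii.
Context {R : realType} {n m : nat}.

Definition linear_field (alpha : 'I_m -> R -> R) (A : 'I_m -> 'M[R]_n)
    (p : R * 'cV[R]_n) : 'cV[R]_n :=
  \sum_(j < m) alpha j p.1 *: (A j *m p.2).

Definition common_complex_eigenvector (B : 'I_m -> 'M[R]_n)
    (nu : 'cV[R[i]]_n) (lambda : 'I_m -> R[i]) : Prop :=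
  nu != 0 /\
  forall j, map_mx (real_complex R) (B j) *m nu = lambda j *: nu.

End LappoDanilevskii.

Definition Re_vec (R : realType) (n : nat) (nu : 'cV[R[i]]_n) : 'cV[R]_n :=
  map_mx (@complex.Re R) nu.

Definition Im_vec (R : realType) (n : nat) (nu : 'cV[R[i]]_n) : 'cV[R]_n :=
  map_mx (@complex.Im R) nu.

(* Main.v *)
(* Along the flow, the pairings [P], [Q] of [x] with the real and imaginary
   parts of [nu] satisfy [P' = L P - M Q] and [Q' = L Q + M P], where [L], [M]
   are the combinations of the [alpha_j] with the real and imaginary parts of
   the eigenvalues; hence [P^2 + Q^2] grows at rate [2 L] and [arctan (Q / P)]
   at rate [M].  Both functions have the form [u(x) a(t) + b(t)], so their
   smoothness reduces to one-variable calculus in [t], where the one-sided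
   derivatives at the ends of [J] come from extending the integrand
   continuously, near the point considered, to the whole line. *)

Require Import Defs.
From HB Require Import structures.
From mathcomp Require Import all_boot all_order all_algebra.
From mathcomp Require Import ring lra.
From mathcomp Require Import all_classical all_reals all_analysis.
From mathcomp.real_closed Require Import complex.

Import Order.TTheory GRing.Theory Num.Theory.
Import numFieldNormedType.Exports.

Local Open Scope classical_set_scope.
Local Open Scope ring_scope.

Set Implicit Arguments.
Unset Strict Implicit.
Unset Printing Implicit Defensive.

(** * Oriented integrals and their derivative in the upper limit *)

Section OrientedIntegral.
Context {R : realType}.
Implicit Types (f g : R -> R) (a b c t : R) (J : set R).

Lemma integrable_itvcc g a b : continuous g ->
  (@lebesgue_measure R).-integrable `[a, b] (EFin \o g).
Proof.
move=> cg; apply: continuous_compact_integrable; first exact: segment_compact.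
exact: continuous_subspaceT.
Qed.

(** A common base point [c] to the left of both limits hides the orientation: additivity gives the
    difference when [a <= b], and the negative of the reversed integral is the same difference
    otherwise. *)
Lemma ointE g a b c : continuous g -> c <= a -> c <= b ->
  oint a b g = Rintegral lebesgue_measure `[c, b] g
             - Rintegral lebesgue_measure `[c, a] g.
Proof.
move=> cg.
have base x y : c <= x -> x <= y -> Rintegral lebesgue_measure `[x, y] g =
    Rintegral lebesgue_measure `[c, y] g - Rintegral lebesgue_measure `[c, x] g.
  move=> cx xy.
  rewrite Rintegral_itvB ?bnd_simp//; last exact: integrable_itvcc.
  rewrite Rintegral_itv_obnd_cbnd//.
  apply: integrableS (integrable_itvcc x y cg) => //.
  exact: subset_itv_oc_cc.
move=> ca cb; rewrite /oint; case: (leP a b) => [ab|/ltW ba].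
  exact: base.
by rewrite (base b a)// opprB.
Qed.

(** The fundamental theorem of calculus, applied with a fixed lower limit on a segment having [t] in
    its interior. *)
Lemma is_derive_oint g a t : continuous g ->
  is_derive t 1 (fun s => oint a s g) (g t).
Proof.
(* [c] lies strictly to the left of both [a] and [t], so [ointE] holds for every [s] near [t], on
   whichever side of [a] it falls. *)
move=> cg; pose c := Num.min a t - 1.
have ca : c < a by rewrite ltrBlDr gt_min ltrDl ltr01.
have ct : c < t by rewrite ltrBlDr gt_min ltrDl ltr01 orbT.
have tt1 : t < t + 1 by rewrite ltrDl.
have [dF F't] := continuous_FTC1_closed tt1 (integrable_itvcc c (t + 1) cg)
  ct (cg t).
apply: (@near_eq_is_derive _ _ _ (fun s =>
  Rintegral lebesgue_measure `[c, s] g - Rintegral lebesgue_measure `[c, a] g)).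
- near=> s; rewrite (@ointE _ _ _ c)//; first exact: ltW.
  by apply: ltW; near: s; exact: lt_nbhsr.
- rewrite -[g t]subr0; apply: is_deriveB.
  by apply: DeriveDef; rewrite -?derive1E.
Unshelve. all: by end_near. Qed.

(** Clamping to [[a, b]] is continuous on the whole line and takes values in [J], where [f] is
    relatively continuous. *)
Lemma continuous_clamp J f a b : {within J, continuous f} -> J a -> J b ->
  is_interval J -> a <= b ->
  continuous (fun s => f (Num.max a (Num.min b s))).
Proof.
move=> cf Ja Jb iJ ab s.
pose k s := Num.max a (Num.min b s).
have Jk x : J (k x).
  apply: (iJ a b) => //; rewrite le_max lexx/= ge_max ab/=.
  by rewrite ge_min lexx.
have ck : {for s, continuous k}.
  apply: continuous_max; first exact: cst_continuous.
  by apply: continuous_min; [exact: cst_continuous|].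
have fk : f x @[x --> within J (nbhs (k s))] --> f (k s).
  by move/subspace_continuousP : cf; apply; exact: Jk.
(* Since [k] never leaves [J], the restriction to [J] in the target filter costs nothing. *)
have kW : k @ s --> within J (nbhs (k s)).
  move=> P wP; suff : \forall x \near s, P (k x) by [].
  have : \forall x \near s, J (k x) -> P (k x) by exact: (ck _ wP).
  by apply: filterS => x; apply; exact: Jk.
exact: (cvg_comp _ _ kW fk).
Qed.

(** Either [J] has a point beyond [t], which bounds a whole neighbourhood of [t], or [t] is the
    maximum of [J] and is itself the bound. The maximum with [t0] brings [t0] below the bound
    too. *)
Lemma interval_ub_near J t0 t : J t0 -> J t ->
  exists b, [/\ J b, t0 <= b, t <= b & \forall s \near t, J s -> s <= b].
Proof.
move=> Jt0 Jt.
have Jmax x y : J x -> J y -> J (Num.max x y) by case: (leP x y).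
have [[b [Jb tb]]|nb] := pselect (exists b, J b /\ t < b).
  exists (Num.max b t0); split.
  - exact: Jmax.
  - by rewrite le_max lexx orbT.
  - by rewrite le_max ltW.
  - near=> s => _; rewrite le_max; apply/orP; left; apply/ltW.
    by near: s; exact: lt_nbhsl.
exists (Num.max t t0); split.
- exact: Jmax.
- by rewrite le_max lexx orbT.
- by rewrite le_max lexx.
- near=> s => Js; rewrite le_max leNgt; apply/orP; left; apply/negP => ts.
  by apply: nb; exists s.
Unshelve. all: by end_near. Qed.

(** The reflection [x |-> - x] turns this into the upper bound case. *)
Lemma interval_lb_near J t0 t : J t0 -> J t ->
  exists a, [/\ J a, a <= t0, a <= t & \forall s \near t, J s -> a <= s].
Proof.
move=> Jt0 Jt.
have [||b [Jb t0b tb nb]] := @interval_ub_near [set x | J (- x)] (- t0) (- t).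
- by rewrite /= opprK.
- by rewrite /= opprK.
exists (- b); split; [exact: Jb|by rewrite lerNl..|].
have {nb} := nb; rewrite nearN /=.
 apply: filterS => s; rewrite /= opprK => + Js.
by rewrite lerNl; apply.
Qed.

(* Freezing [f] outside a segment of [J] that contains [t0] and a
   neighbourhood of [t] in [J] makes it continuous on the whole line, so that
   two-sided calculus applies at the ends of [J] as well. *)
Lemma local_continuous_extension J f t0 t : is_interval J ->
    {within J, continuous f} -> J t0 -> J t ->
  exists2 g, continuous g & \forall s \near t, J s ->
    f s = g s /\ oint t0 s f = oint t0 s g.
Proof.
move=> iJ cf Jt0 Jt.
have [b [Jb t0b tb nb]] := interval_ub_near Jt0 Jt.
have [a [Ja at0 ta na]] := interval_lb_near Jt0 Jt.
have ab := le_trans at0 t0b.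
exists (fun s => f (Num.max a (Num.min b s))).
  exact: continuous_clamp cf Ja Jb iJ ab.
have E s : a <= s -> s <= b -> f s = f (Num.max a (Num.min b s)).
  by move=> as_ sb; rewrite min_r// max_r.
near=> s => Js.
have sb : s <= b by move: Js; near: s.
have as_ : a <= s by move: Js; near: s.
split; first exact: E.
(* In either orientation the integration variable lies between [t0] and [s], hence in [[a, b]],
   where clamping changes nothing. *)
rewrite /oint; case: (leP t0 s) => t0s; [|congr (- _)]; apply: eq_Rintegral.
- move=> x; rewrite inE/= in_itv/= => /andP[t0x xs].
  by apply: E; [exact: le_trans t0x|exact: le_trans sb].
- move=> x; rewrite inE/= in_itv/= => /andP[t0x xs].
  by apply: E; [exact: le_trans t0x|exact: le_trans t0b].
Unshelve. all: by end_near. Qed.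

End OrientedIntegral.

(** * Directional derivatives relative to a set *)

Section DerivativeWithin.
Context {R : realType} {V W : normedModType R}.
Implicit Types (G : set V) (f g : V -> W) (a v : V) (l : W).

(** Convergence to a named value can be transferred between filters and functions before uniqueness
    of the limit is addressed. *)
Definition is_derive_in G f a v l : Prop :=
  (fun h => h^-1 *: ((f \o shift a) (h *: v) - f a)) @
    within [set h : R | G (h *: v + a)] 0^' --> l.

(** Properness of the filter of admissible increments makes the limit unique, which identifies
    [derive_in] with [l]. *)
Lemma is_derive_in_val G f a v l :
  ProperFilter (within [set h : R | G (h *: v + a)] 0^') ->
  is_derive_in G f a v l -> derivable_in G f a v /\ derive_in G f a v = l.
Proof.
move=> PF fl; split; first by apply/cvg_ex; exists l.
exact: cvg_lim fl.
Qed.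

Lemma is_derive_is_derive_in G f a v l :
  is_derive a v f l -> is_derive_in G f a v l.
Proof.
move=> [dvf <-]; apply: cvg_trans dvf.
exact/cvg_app/cvg_within.
Qed.

(** The admissible increments stay in [G], and [a] itself is in [G], so both terms of the difference
    quotients agree for small [h]. *)
Lemma near_is_derive_in G f g a v l :
  G a -> (\forall q \near a, G q -> f q = g q) ->
  is_derive_in G g a v l -> is_derive_in G f a v l.
Proof.
move=> Ga fg; apply: cvg_trans; apply: near_eq_cvg.
have ct : (fun h : R => h *: v + a) @ 0 --> a.
  rewrite -[X in _ --> X]add0r -[X in _ --> X + _](scale0r v).
  by apply: cvgD; [exact: cvgZr_tmp | exact: cvg_cst].
have := ct _ fg => /nbhs_dnbhs; rewrite near_withinE.
apply: filterS => h /= + Gh; rewrite /shift/= => /(_ Gh) ->.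
by rewrite (nbhs_singleton fg Ga).
Qed.

End DerivativeWithin.

(** * Admissible increments in a nondegenerate interval *)

Section Line.
Context {R : realType}.

(** The interval has a point [s] other than [t], and the segment from [t] to [s] supplies
    arbitrarily small nonzero increments inside [J]. *)
Lemma interval_within_proper (J : set R) t : interval_set J -> J t ->
  ProperFilter (within [set h : R | J (h *: 1 + t)] 0^').
Proof.
move=> [iJ [s1 [s2 [Js1 Js2 s12]]]] Jt.
have [s Js st] : exists2 s, J s & s != t.
  have [t1|] := eqVneq s1 t; last by exists s1.
  by exists s2 => //; rewrite -t1 gt_eqF.
apply: Build_ProperFilter_ex => // P [e /= e0 eP].
(* The bound 1 keeps [t + k * (s - t)] on the segment from [t] to [s]; the other bound makes the
   increment at most [e / 2], hence strictly smaller than [e]. *)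
pose k := Num.min 1 (e / 2 / `|s - t|).
have st0 : 0 < `|s - t| by rewrite normr_gt0 subr_eq0.
have k0 : 0 < k by rewrite lt_min ltr01 !divr_gt0.
have k1 : k <= 1 by rewrite ge_min lexx.
have ke : k * `|s - t| < e.
  rewrite (@le_lt_trans _ _ (e / 2))//.
    by rewrite -ler_pdivlMr// ge_min lexx orbT.
  by rewrite ltr_pdivrMr// ltr_pMr// ltr1n.
exists (k * (s - t)); apply: eP => /=.
- by rewrite sub0r normrN normrM (gtr0_norm k0).
- by rewrite mulf_neq0 ?(gt_eqF k0)// subr_eq0.
- rewrite [_ *: _]mulr1.
  have [st1|/ltW st1] := leP s t; [apply: (iJ s t)|apply: (iJ t s)] => //;
    apply/andP; split; nra.
Qed.

End Line.

(** * Chain rule and continuity for functions of an oriented integral *)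

Section CompositionWithOint.
Context {R : realType}.
Variables (J : set R) (f : R -> R) (t0 t : R).
Hypotheses (iJ : is_interval J) (cf : {within J, continuous f}).
Hypotheses (Jt0 : J t0) (Jt : J t).

(** Near [t] the integrand may be replaced by its continuous extension to the line, to which the
    two-sided chain rule and [is_derive_oint] apply. *)
Lemma is_derive_in_comp_oint (phi phi' : R -> R) :
  (forall x : R, is_derive x 1 phi (phi' x)) ->
  is_derive_in J (fun s => phi (oint t0 s f)) t 1 (phi' (oint t0 t f) * f t).
Proof.
move=> dphi; have [g cg fg] := local_continuous_extension iJ cf Jt0 Jt.
have [-> ->] := nbhs_singleton fg Jt.
apply: (@near_is_derive_in _ _ _ _ _ (phi \o (fun s => oint t0 s g))) => //.
  by apply: filterS fg => s /= fgs /fgs[_ ->].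
apply: is_derive_is_derive_in; apply: is_derive1_comp; exact: is_derive_oint.
Qed.

Lemma cvg_within_oint :
  oint t0 s f @[s --> within J (nbhs t)] --> oint t0 t f.
Proof.
have [g cg fg] := local_continuous_extension iJ cf Jt0 Jt.
have [_ ->] := nbhs_singleton fg Jt.
apply: cvg_trans (_ : oint t0 s g @[s --> within J (nbhs t)] --> _).
  apply: near_eq_cvg; rewrite near_withinE.
  by apply: filterS fg => s /= fgs /fgs[_ ->].
apply: cvg_within_filter.
apply: differentiable_continuous; apply/derivable1_diffP.
by have [] := is_derive_oint t0 t cg.
Qed.

End CompositionWithOint.

Lemma within_continuous_comp_oint (R : realType) (J : set R)
    (f phi : R -> R) t0 :
  is_interval J -> {within J, continuous f} -> J t0 -> continuous phi ->
  {within J, continuous (fun s => phi (oint t0 s f))}.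
Proof.
move=> iJ cf Jt0 cphi; apply/subspace_continuousP => t Jt.
exact: (cvg_comp _ _ (cvg_within_oint iJ cf Jt0 Jt) (cphi _)).
Qed.

(** * First integrals of the form [u(x) a(t) + b(t)] *)

Section Separable.
Context {R : realType} {n : nat}.
Variables (J : set R) (U : set 'cV[R]_n).
Implicit Types (u : 'cV[R]_n -> R) (a b : R -> R).

Lemma within_continuous_separable u a b :
  (forall x, U x -> {for x, continuous u}) ->
  {within J, continuous a} -> {within J, continuous b} ->
  {within J `*` U, continuous (fun p => u p.2 * a p.1 + b p.1)}.
Proof.
move=> cu /subspace_continuousP ca /subspace_continuousP cb.
apply/subspace_continuousP => -[t x] [/= Jt Ux].
have c1 : p.1 @[p --> within (J `*` U) (nbhs (t, x))] --> within J (nbhs t).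
  move=> P wP.
  suff : \forall p \near within (J `*` U) (nbhs (t, x)), P p.1 by [].
  rewrite near_withinE.
  have : \forall p \near (t, x), J p.1 -> P p.1.
    exact: (@cvg_fst _ _ (nbhs t) (nbhs x) _ _ wP).
  by apply: filterS => -[s y] /= JP [Js _]; exact: JP.
have c2 : p.2 @[p --> within (J `*` U) (nbhs (t, x))] --> nbhs x.
  by apply: cvg_within_filter; exact: cvg_snd.
apply: cvgD; last exact: (cvg_comp _ _ c1 (cb _ Jt)).
apply: cvgM; last exact: (cvg_comp _ _ c1 (ca _ Jt)).
exact: (cvg_comp _ _ c2 (cu _ Ux)).
Qed.

(** An increment along [dir_t] leaves [x] fixed, so it is admissible for [J * U] exactly when it is
    admissible for [J], and [u x] is a constant factor. *)
Lemma is_derive_in_separable_t u a b (a' b' : R) t x : U x ->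
  is_derive_in J a t 1 a' -> is_derive_in J b t 1 b' ->
  is_derive_in (J `*` U) (fun p => u p.2 * a p.1 + b p.1) (t, x) dir_t
    (u x * a' + b').
Proof.
move=> Ux da db; rewrite /is_derive_in.
have -> : [set h : R | (J `*` U) (h *: dir_t + (t, x))] =
          [set h | J (h *: 1 + t)].
  by apply/seteqP; split => h /=; rewrite scaler0 add0r => // -[].
rewrite (_ : (fun _ => _) = fun h =>
    u x * (h^-1 *: ((a \o shift t) (h *: 1) - a t)) +
    (h^-1 *: ((b \o shift t) (h *: 1) - b t))).
  by apply: cvgD => //; apply: cvgM => //; exact: cvg_cst.
apply/funext => h /=; rewrite scaler0 add0r /GRing.scale/=; ring.
Qed.

(** An increment along [dir_x xi] leaves [t] fixed: [b t] cancels and [a t] is a constant factor. *)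
Lemma is_derive_in_separable_x u a b du t x xi : J t ->
  is_derive_in U u x (delta_mx xi 0) du ->
  is_derive_in (J `*` U) (fun p => u p.2 * a p.1 + b p.1) (t, x) (dir_x xi)
    (du * a t).
Proof.
move=> Jt dux; rewrite /is_derive_in.
have -> : [set h : R | (J `*` U) (h *: dir_x xi + (t, x))] =
          [set h | U (h *: delta_mx xi 0 + x)].
  by apply/seteqP; split => h /=; rewrite scaler0 add0r => // -[].
rewrite (_ : (fun _ => _) = fun h =>
    (h^-1 *: ((u \o shift x) (h *: delta_mx xi 0) - u x)) * a t).
  by apply: cvgM => //; exact: cvg_cst.
apply/funext => h /=; rewrite scaler0 add0r /GRing.scale/=; ring.
Qed.

(** Every partial derivative is again separable, [u a' + b'] in time and [du a] in space, so one
    continuity lemma serves the function and all its partials, and the required identity becomes the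
    last hypothesis. *)
Lemma first_integral_separable (X : R * 'cV[R]_n -> 'cV[R]_n)
    u a b (du : 'I_n -> 'cV[R]_n -> R) (a' b' : R -> R) :
  interval_set J -> open U ->
  (forall x, U x -> {for x, continuous u}) ->
  (forall xi x, U x -> {for x, continuous (du xi)}) ->
  {within J, continuous a} -> {within J, continuous b} ->
  {within J, continuous a'} -> {within J, continuous b'} ->
  (forall xi x, U x -> is_derive x (delta_mx xi 0) u (du xi x)) ->
  (forall t, J t -> is_derive_in J a t 1 (a' t)) ->
  (forall t, J t -> is_derive_in J b t 1 (b' t)) ->
  (forall t x, J t -> U x ->
    u x * a' t + b' t + \sum_xi X (t, x) xi 0 * (du xi x * a t) = 0) ->
  first_integral X (J `*` U) (fun p => u p.2 * a p.1 + b p.1).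
Proof.
move=> hJ oU cu cdu ca cb ca' cb' hu ha hb eqn.
set F := fun p => _.
have dt p : (J `*` U) p -> derivable_in (J `*` U) F p dir_t /\
    derive_in (J `*` U) F p dir_t = u p.2 * a' p.1 + b' p.1.
  (* In the time direction properness comes from the nondegeneracy of [J]; in the space directions
     below it comes from the openness of [U]. *)
  case: p => t x [/= Jt Ux]; apply: is_derive_in_val.
    rewrite (_ : [set h | _] = [set h | J (h *: 1 + t)]).
      exact: interval_within_proper.
    by apply/seteqP; split => h /=; rewrite scaler0 add0r => // -[].
  by apply: is_derive_in_separable_t => //; [exact: ha|exact: hb].
(* The zero summand [cst 0] gives this derivative the separable shape that
   [within_continuous_separable] expects. *)
have dx xi p : (J `*` U) p -> derivable_in (J `*` U) F p (dir_x xi) /\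
    derive_in (J `*` U) F p (dir_x xi) = du xi p.2 * a p.1 + (cst 0) p.1.
  case: p => t x [/= Jt Ux]; apply: is_derive_in_val; last first.
    rewrite addr0; apply: is_derive_in_separable_x => //.
    exact/is_derive_is_derive_in/hu.
  rewrite (_ : [set h | _] = [set h | U (h *: delta_mx xi 0 + x)]).
    by rewrite within_dnbhs_open//; exact: Proper_dnbhs_numFieldType.
  by apply/seteqP; split => h /=; rewrite scaler0 add0r => // -[].
have within_eq (D E : R * 'cV[R]_n -> R) :
    (forall p, (J `*` U) p -> D p = E p) ->
    {within J `*` U, continuous E} -> {within J `*` U, continuous D}.
  by move=> DE; apply: subspace_eq_continuous => p; rewrite inE => /DE.
split; first split.
- exact: within_continuous_separable.
- split=> [p /dt[]//|].
  apply: (within_eq _ (fun p => u p.2 * a' p.1 + b' p.1)) => [p Gp|].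
    exact: (dt _ Gp).2.
  exact: within_continuous_separable.
- move=> xi; split=> [p /(dx xi)[]//|].
  apply: (within_eq _ (fun p => du xi p.2 * a p.1 + cst 0 p.1)) => [p Gp|].
    exact: (dx _ _ Gp).2.
  apply: within_continuous_separable => //; first exact: cdu.
  by apply: continuous_subspaceT; exact: cst_continuous.
- move=> [t x] Gp; rewrite (dt _ Gp).2.
  under eq_bigr do rewrite (dx _ _ Gp).2 addr0.
  by case: Gp => Jt Ux; exact: eqn.
Qed.

End Separable.

(** * Directional derivatives by restriction to a line *)

Section ChainRule.
Context {R : realType} {V : normedModType R}.

Lemma is_derive_line (f : V -> R) (x v : V) (l : R) :
  is_derive x v f l <-> is_derive (0 : R) 1 (fun h : R => f (h *: v + x)) l.
Proof.
have E : 'D_v f x = 'D_1 (fun h : R => f (h *: v + x)) 0.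
  rewrite /derive (_ : (fun h => h^-1 *: (_ - f x)) = fun h : R => h^-1 *:
      (((fun h => f (h *: v + x)) \o shift 0) (h *: 1) - f (0 *: v + x)))//.
  apply/funext => h /=.
  by rewrite addr0 scale0r add0r [h *: 1]mulr1.
split=> -[dfx dfE].
- by split; [move/derivable1P : dfx|rewrite -E].
- by split; [apply/derivable1P|rewrite E].
Qed.

(** Restricting [g] to the line through [x] along [v] reduces this to the one-variable chain rule,
    so a derivative of [g] in the single direction [v] suffices. *)
Lemma is_derive_comp1 (phi : R -> R) (g : V -> R) (x v : V) (dphi dg : R) :
  is_derive x v g dg -> is_derive (g x) 1 phi dphi ->
  is_derive x v (phi \o g) (dphi * dg).
Proof.
move=> /is_derive_line dgx dphix; apply/is_derive_line.
apply: (is_derive1_comp (f := phi) (g := fun h : R => g (h *: v + x))).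
by rewrite scale0r add0r.
Qed.

End ChainRule.

(** * The pairing, and derivatives of the modulus and the angle *)

Section Pairing.
Context {R : realType} {n : nat}.
Implicit Types (u w x : 'cV[R]_n).

Lemma pairingE u x : pairing u x = (u^T *m x) 0 0.
Proof. by rewrite mxE; apply: eq_bigr => i _; rewrite mxE. Qed.

Lemma pairing_mulmx u (A : 'M[R]_n) x :
  pairing u (A *m x) = pairing (A^T *m u) x.
Proof. by rewrite !pairingE trmx_mul trmxK mulmxA. Qed.

Lemma pairing_delta u xi : pairing u (delta_mx xi 0) = u xi 0.
Proof. by rewrite pairingE -colE !mxE. Qed.

Lemma pairingDr u x y : pairing u (x + y) = pairing u x + pairing u y.
Proof. by rewrite !pairingE mulmxDr mxE. Qed.

Lemma pairingZr u c x : pairing u (c *: x) = c * pairing u x.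
Proof. by rewrite !pairingE -scalemxAr mxE. Qed.

Lemma pairing_sumr u m (x : 'I_m -> 'cV[R]_n) :
  pairing u (\sum_j x j) = \sum_j pairing u (x j).
Proof.
rewrite pairingE mulmx_sumr summxE; apply: eq_bigr => j _.
by rewrite pairingE.
Qed.

Lemma pairing_combl c d u w x :
  pairing (c *: u + d *: w) x = c * pairing u x + d * pairing w x.
Proof.
rewrite !pairingE linearP/= mulmxDl -!scalemxAl linearZ/= -scalemxAl.
by rewrite !mxE.
Qed.

Lemma continuous_pairing u : continuous (pairing u).
Proof.
apply: continuous_big => [|i _ x]; first exact: add_continuous.
have cx : {for x, continuous (fun y : 'cV[R]_n => y i 0)}.
  exact: coord_continuous.
exact: (@cvgM _ _ (nbhs x) _ (cst (u i 0)) _ _ _ (cvg_cst _) cx).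
Qed.

Lemma is_derive_pairing u x v : is_derive x v (pairing u) (pairing u v).
Proof.
apply/is_derive_line; rewrite (_ : (fun h : R => _) =
    (fun h => pairing u v * h + pairing u x)).
  by apply: is_derive_eq; rewrite addr0 [_ *: _]mulr1.
by apply/funext => h; rewrite pairingDr pairingZr mulrC.
Qed.

Lemma is_derive_sqr_pairing u w x v :
  is_derive x v (fun x => pairing u x ^+ 2 + pairing w x ^+ 2)
    (2 * pairing u x * pairing u v + 2 * pairing w x * pairing w v).
Proof.
apply: (is_deriveD (f := pairing u ^+ 2) (g := pairing w ^+ 2)).
  exact: is_deriveX (is_derive_pairing _ _ _).
exact: is_deriveX (is_derive_pairing _ _ _).
Qed.

(** With [P], [Q] the pairings of [x] with [u], [w], this is the differential of the polar angle,
    [(P dQ - Q dP) / (P^2 + Q^2)], split into its [dP] and [dQ] coefficients. *)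
Lemma is_derive_atan_pairing u w x v : pairing u x != 0 ->
  is_derive x v (fun x => atan (pairing w x / pairing u x))
    (- (pairing w x / (pairing u x ^+ 2 + pairing w x ^+ 2)) * pairing u v +
     pairing u x / (pairing u x ^+ 2 + pairing w x ^+ 2) * pairing w v).
Proof.
move=> ux0.
have dV : is_derive (pairing u x) 1 GRing.inv (- (pairing u x) ^- 2).
  have := is_deriveV (f := id) ux0 (is_derive_id (pairing u x) (1 : R)).
  by rewrite [_ *: _]mulr1.
have D := is_derive_comp1 (is_deriveM (is_derive_pairing w x v)
  (is_derive_comp1 (is_derive_pairing u x v) dV)) (is_derive1_atan _).
apply: (is_derive_eq D).
rewrite (_ : (_ * (_ \o _)) x = pairing w x / pairing u x)//.
rewrite /GRing.scale/=.
have : pairing u x ^+ 2 + pairing w x ^+ 2 != 0.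
  by rewrite paddr_eq0 ?sqr_ge0// sqrf_eq0 (negbTE ux0).
move: (pairing u x) (pairing w x) ux0 => P Q P0 PQ.
by field; rewrite PQ.
Qed.

End Pairing.

(** * Real and imaginary parts of the eigenvector equation *)

Section Eigenvector.
Context {R : realType} {n : nat}.

Lemma Re_vec_mulmx (B : 'M[R]_n) (nu : 'cV[R[i]]_n) :
  Re_vec (map_mx (real_complex R) B *m nu) = B *m Re_vec nu.
Proof.
apply/colP => k; rewrite !mxE raddf_sum; apply: eq_bigr => i _.
by rewrite !mxE; case: (nu i 0) => p q /=; rewrite mul0r subr0.
Qed.

Lemma Im_vec_mulmx (B : 'M[R]_n) (nu : 'cV[R[i]]_n) :
  Im_vec (map_mx (real_complex R) B *m nu) = B *m Im_vec nu.
Proof.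
apply/colP => k; rewrite !mxE raddf_sum; apply: eq_bigr => i _.
by rewrite !mxE; case: (nu i 0) => p q /=; rewrite mul0r addr0.
Qed.

Lemma Re_vecZ (c : R[i]) (nu : 'cV[R[i]]_n) : Re_vec (c *: nu) =
  complex.Re c *: Re_vec nu + (- complex.Im c) *: Im_vec nu.
Proof.
apply/colP => k; rewrite !mxE.
by case: c (nu k 0) => c d [p q] /=; rewrite mulNr.
Qed.

Lemma Im_vecZ (c : R[i]) (nu : 'cV[R[i]]_n) : Im_vec (c *: nu) =
  complex.Re c *: Im_vec nu + complex.Im c *: Re_vec nu.
Proof. by apply/colP => k; rewrite !mxE; case: c (nu k 0) => c d [p q]. Qed.

Context {m : nat}.
Variables (alpha : 'I_m -> R -> R) (A : 'I_m -> 'M[R]_n).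
Variables (nu : 'cV[R[i]]_n) (lambda : 'I_m -> R[i]).
Hypothesis hnu : common_complex_eigenvector (fun j => (A j)^T) nu lambda.

(** Transposition moves each [A j] onto [Re_vec nu]; the real part of the eigenvector equation then
    expresses the result through [Re_vec nu] and [Im_vec nu]. *)
Lemma pairing_Re_linear_field t x :
  pairing (Re_vec nu) (linear_field alpha A (t, x)) =
  (\sum_j complex.Re (lambda j) * alpha j t) * pairing (Re_vec nu) x -
  (\sum_j complex.Im (lambda j) * alpha j t) * pairing (Im_vec nu) x.
Proof.
rewrite pairing_sumr !mulr_suml -sumrB; apply: eq_bigr => j _ /=.
rewrite pairingZr pairing_mulmx -Re_vec_mulmx (hnu.2 j) Re_vecZ pairing_combl.
ring.
Qed.

Lemma pairing_Im_linear_field t x :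
  pairing (Im_vec nu) (linear_field alpha A (t, x)) =
  (\sum_j complex.Re (lambda j) * alpha j t) * pairing (Im_vec nu) x +
  (\sum_j complex.Im (lambda j) * alpha j t) * pairing (Re_vec nu) x.
Proof.
rewrite pairing_sumr !mulr_suml -big_split; apply: eq_bigr => j _ /=.
rewrite pairingZr pairing_mulmx -Im_vec_mulmx (hnu.2 j) Im_vecZ pairing_combl.
ring.
Qed.

End Eigenvector.

(** * Assembly of the two first integrals *)

Lemma within_continuous_lincomb (R : realType) (J : set R) m (c : 'I_m -> R)
    (alpha : 'I_m -> R -> R) :
  (forall j, {within J, continuous (alpha j)}) ->
  {within J, continuous (fun t => \sum_j c j * alpha j t)}.
Proof.
move=> ca; apply/subspace_continuousP => t Jt.
apply: cvg_big => [|j _]; first exact: add_continuous.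
apply: cvgM; first exact: cvg_cst.
by move/subspace_continuousP : (ca j); apply.
Qed.

Theorem theorem2p6 (R : realType) (n m : nat) (J : set R)
  (alpha : 'I_m -> R -> R) (A : 'I_m -> 'M[R]_n)
  (nu : 'cV[R[i]]_n) (lambda : 'I_m -> R[i]) (t0 : R)
  (hJ : interval_set J)
  (halpha : forall j, {within J, continuous (alpha j)})
  (hindep : lin_indep_on J alpha)
  (hcomm : forall j k, A j *m A k = A k *m A j)
  (hnu : common_complex_eigenvector (fun j => (A j)^T) nu lambda)
  (hIm : Im_vec nu != 0)
  (ht0 : J t0) :
  first_integral (linear_field alpha A) (J `*` [set: 'cV[R]_n])
    (fun p => (pairing (Re_vec nu) p.2 ^+ 2 + pairing (Im_vec nu) p.2 ^+ 2) *
       expR (- 2 * oint t0 p.1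
                     (fun tau => \sum_(j < m) complex.Re (lambda j) * alpha j tau)))
  /\
  forall X : set 'cV[R]_n,
    domain R X ->
    X `<=` [set x | pairing (Re_vec nu) x != 0] ->
    first_integral (linear_field alpha A) (J `*` X)
      (fun p => atan (pairing (Im_vec nu) p.2 / pairing (Re_vec nu) p.2) -
         oint t0 p.1
           (fun tau => \sum_(j < m) complex.Im (lambda j) * alpha j tau)).
Proof.
have [iJ _] := hJ.
set a := Re_vec nu; set b := Im_vec nu.
pose L t := \sum_(j < m) complex.Re (lambda j) * alpha j t.
pose M t := \sum_(j < m) complex.Im (lambda j) * alpha j t.
have cL : {within J, continuous L} by exact: within_continuous_lincomb.
have cM : {within J, continuous M} by exact: within_continuous_lincomb.
have wmul (f g : R -> R) : {within J, continuous f} ->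
    {within J, continuous g} -> {within J, continuous (fun t => f t * g t)}.
  move=> /subspace_continuousP cf /subspace_continuousP cg.
  by apply/subspace_continuousP => t Jt; apply: cvgM; [exact: cf|exact: cg].
have wcst (c : R) : {within J, continuous (fun _ : R => c)}.
  by apply: continuous_subspaceT; exact: cst_continuous.
have dcst (c : R) t : is_derive_in J (fun _ : R => c) t 1 0.
  by apply: is_derive_is_derive_in; exact: is_derive_cst.
(* Both functions have a spatial gradient of the form [(p a + r b) e]; contracting it with the field
   leaves only the two pairings of the field with [a] and [b], which are already known. *)
have sumX t x (p r e : R) :
    \sum_xi linear_field alpha A (t, x) xi 0 *
       ((p * pairing a (delta_mx xi 0) + r * pairing b (delta_mx xi 0)) * e) =
    (p * (L t * pairing a x - M t * pairing b x) +
     r * (L t * pairing b x + M t * pairing a x)) * e.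
  rewrite -(pairing_Re_linear_field alpha hnu).
  rewrite -(pairing_Im_linear_field alpha hnu).
  rewrite -pairing_combl [in RHS]/pairing mulr_suml; apply: eq_bigr => xi _.
  by rewrite !pairing_delta !mxE; ring.
split.
(* Separable form with the exponential as time factor and zero as additive term. *)
- rewrite (_ : (fun p => _) = fun p =>
    (pairing a p.2 ^+ 2 + pairing b p.2 ^+ 2) * expR (- 2 * oint t0 p.1 L) + 0).
    have dE (y : R) :
        is_derive y 1 (fun y => expR (- 2 * y)) (expR (- 2 * y) * - 2).
      have D : is_derive y 1 (fun y : R => - 2 * y) (- 2).
        by apply: is_derive_eq; rewrite [_ *: _]mulr1.
      exact: (is_derive1_comp (f := expR)).
    have cE : continuous (fun y : R => expR (- 2 * y)).
      move=> y; apply: differentiable_continuous; apply/derivable1_diffP.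
      by have [] := dE y.
    have cp c : continuous (fun x => pairing c x ^+ 2).
      by move=> x; apply: (@cvgM _ _ (nbhs x)); exact: continuous_pairing.
    apply: (first_integral_separable (a := fun t => expR (- 2 * oint t0 t L))
      (a' := fun t => expR (- 2 * oint t0 t L) * - 2 * L t)
      (b := fun _ => 0) (b' := fun _ => 0)
      (u := fun x => pairing a x ^+ 2 + pairing b x ^+ 2)
      (du := fun xi x => 2 * pairing a x * pairing a (delta_mx xi 0) +
                         2 * pairing b x * pairing b (delta_mx xi 0))) => //.
    + exact: openT.
    + by move=> x _; apply: (@cvgD _ _ _ (nbhs x)); exact: cp.
    + move=> xi x _; apply: (@cvgD _ _ _ (nbhs x));
        apply: (@cvgM _ _ (nbhs x)); try exact: cvg_cst;
        apply: (@cvgM _ _ (nbhs x)); try exact: cvg_cst;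
        exact: continuous_pairing.
    + exact: (within_continuous_comp_oint iJ cL ht0 cE).
    + apply: (wmul _ _ _ cL); apply: (wmul _ _ _ (wcst _)).
      exact: (within_continuous_comp_oint iJ cL ht0 cE).
    + by move=> xi x _; exact: is_derive_sqr_pairing.
    + by move=> t Jt; exact: (is_derive_in_comp_oint iJ cL ht0 Jt dE).
    (* With [p = 2 P] and [r = 2 Q] the [M] terms cancel, and the remaining [2 L (P^2 + Q^2)] is
       balanced by the factor [- 2 L] from the exponential. *)
    + by move=> t x _ _; rewrite sumX; ring.
  by apply/funext => p; rewrite addr0.
- move=> X [oX _] Xa.
  (* Separable form with time factor 1 and the negated integral as additive term. *)
  rewrite (_ : (fun p => _) = fun p =>
    atan (pairing b p.2 / pairing a p.2) * 1 + - oint t0 p.1 M).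
    have cN : continuous (fun y : R => - y) by exact: opp_continuous.
    have ca x : X x -> {for x, continuous (fun x => (pairing a x)^-1)}.
      move=> Xx; apply: (@cvgV _ _ (nbhs x)); first exact: Xa.
      exact: continuous_pairing.
    have D0 x : X x -> pairing a x ^+ 2 + pairing b x ^+ 2 != 0.
      by move=> /Xa ax0; rewrite paddr_eq0 ?sqr_ge0// sqrf_eq0 (negbTE ax0).
    have cD x : X x ->
        {for x, continuous (fun x => (pairing a x ^+ 2 + pairing b x ^+ 2)^-1)}.
      move=> Xx; apply: (@cvgV _ _ (nbhs x)); first exact: D0.
      by apply: (@cvgD _ _ _ (nbhs x)); apply: (@cvgM _ _ (nbhs x));
        exact: continuous_pairing.
    apply: (first_integral_separable (a := fun _ => 1) (a' := fun _ => 0)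
      (b := fun t => - oint t0 t M) (b' := fun t => - 1 * M t)
      (u := fun x => atan (pairing b x / pairing a x))
      (du := fun xi x =>
        - (pairing b x / (pairing a x ^+ 2 + pairing b x ^+ 2)) *
          pairing a (delta_mx xi 0) +
        pairing a x / (pairing a x ^+ 2 + pairing b x ^+ 2) *
          pairing b (delta_mx xi 0))) => //.
    + move=> x Xx.
      apply: (continuous_comp (f := fun x => pairing b x / pairing a x)).
        by apply: (@cvgM _ _ (nbhs x)); [exact: continuous_pairing|exact: ca].
      exact: continuous_atan.
    + move=> xi x Xx; apply: (@cvgD _ _ _ (nbhs x));
        apply: (@cvgM _ _ (nbhs x)); try exact: cvg_cst.
        apply: (@cvgN _ _ _ (nbhs x)); apply: (@cvgM _ _ (nbhs x)).
          exact: continuous_pairing.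
        exact: cD.
      apply: (@cvgM _ _ (nbhs x)); first exact: continuous_pairing.
      exact: cD.
    + exact: (within_continuous_comp_oint iJ cM ht0 cN).
    + exact: wmul.
    + by move=> xi x Xx; apply: is_derive_atan_pairing; exact: Xa.
    + by move=> t Jt; apply: (is_derive_in_comp_oint (phi := -%R)
        (phi' := fun=> - 1) iJ cM ht0 Jt).
    (* Here [p = - Q / (P^2 + Q^2)] and [r = P / (P^2 + Q^2)]: the [L] terms cancel, and the [M]
       terms add up to [M], which balances the derivative [- M] of the additive term. *)
    + move=> t x _ Xx; rewrite sumX; have := D0 _ Xx.
      by move: (pairing a x) (pairing b x) => P Q PQ; field.
  by apply/funext => p; rewrite mulr1.
Qed.
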